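(* Every wreath-closed permutation class is unsplittable. In particular, if $\pi$ is a simple permutation, then the class $\mathrm{Av}(\pi)$ is unsplittable.
   Context: A permutation of order $n\ge 1$ is a sequence of the $n$ distinct numbers of $[n]=\{1,\dots,n\}$ (permutations are nonempty). A permutation $\pi$ contains a permutation $\sigma$ if $\pi$ has a subsequence order-isomorphic to $\sigma$; otherwise $\pi$ avoids $\sigma$. $\mathrm{Av}(\sigma)$ is the set of all $\sigma$-avoiding permutations. A permutation class is a set of permutations closed under taking contained permutations. The inflation $\pi[\sigma_1,\dots,\sigma_n]$ of $\pi\in S_n$ by nonempty permutations $\sigma_1,\dots,\sigma_n$ is the permutation that is a concatenation of sequences $\overline{\sigma}_1\cdots\overline{\sigma}_n$ such that $\overline\sigma_i$ is order-isomorphic to $\sigma_i$ for each $i$, and whenever $\pi(i)<\pi(j)$, all elements of $\overline\sigma_i$ are smaller than all elements of $\overline\sigma_j$. A permutation $\pi$ is simple if it cannot be obtained by an inflation except for the trivial inflations $\pi[1,\dots,1]$ and $1[\pi]$. For sets $A,B$ of permutations, $A\wr B$ is the set of all permutations obtained by inflating an element of $A$ by a sequence of elements of $B$. A set $Y$ of permutations is wreath-closed if $Y\wr Y\subseteq Y$. For permutation classes $P_1,\dots,P_m$, let $P_1\odot\dots\odot P_m$ be the set of all permutations whose entries can be colored by $m$ colors so that for each $i$ the subsequence of color $i$ is either empty or order-isomorphic to an element of $P_i$. A multiset $\{P_1,\dots,P_m\}$ of permutation classes is a splitting of a class $C$ if $C\subseteq P_1\odot\dots\odot P_m$; the $P_i$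 are its parts. The splitting is nontrivial if no part is a superset of $C$. A class is splittable if it has a nontrivial splitting, and unsplittable otherwise. *)

(* Defs.v *)
From HB Require Import structures.
From mathcomp Require Import all_boot.
From mathcomp Require Import classical_sets.

Set Implicit Arguments.
Unset Strict Implicit.
Unset Printing Implicit Defensive.

Local Open Scope classical_set_scope.

(* Permutations of any order n >= 1, in one-line notation with entries 1..n. *)
Definition is_permutation (s : seq nat) : bool :=
  (0 < size s) && perm_eq s (iota 1 (size s)).

Record permutation := Permutation {
  one_line :> seq nat;
  one_lineP : is_permutation one_line }.

HB.instance Definition _ := [isSub for one_line].
HB.instance Definition _ := [Countable of permutation by <:].

(* Only meant for sequences without repeated entries. *)
Definition order_iso (s t : seq nat) : Prop :=
  size s = size t /\
  forall i j, i < size s -> j < size s ->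
    (nth 0 s i < nth 0 s j) = (nth 0 t i < nth 0 t j).

Definition contains (pi sigma : permutation) : Prop :=
  exists2 s : seq nat, subseq s pi & order_iso s sigma.

Definition Av (sigma : permutation) : set permutation :=
  [set pi | ~ contains pi sigma].

Definition permutation_class (C : set permutation) : Prop :=
  forall pi sigma, C pi -> contains pi sigma -> C sigma.

(* tau = pi[sigma_1, ..., sigma_n]; the indices are shifted to 0, ..., n-1. *)
Definition is_inflation (pi : permutation)
    (sigma : 'I_(size pi) -> permutation) (tau : permutation) : Prop :=
  exists b : 'I_(size pi) -> seq nat,
    [/\ one_line tau = flatten [seq b i | i <- enum 'I_(size pi)],
        forall i, order_iso (b i) (sigma i)
      & forall i j : 'I_(size pi), nth 0 pi i < nth 0 pi j ->
          forall x y, x \in b i -> y \in b j -> x < y].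

Definition permutation1 : permutation := @Permutation [:: 1] isT.

Definition simple_permutation (pi : permutation) : Prop :=
  forall (rho : permutation) (sigma : 'I_(size rho) -> permutation),
    is_inflation sigma pi ->
    (rho = pi /\ forall i, sigma i = permutation1) \/
    (rho = permutation1 /\ forall i, sigma i = pi).

Definition wreath (A B : set permutation) : set permutation :=
  [set tau | exists2 pi : permutation, A pi &
     exists2 sigma : 'I_(size pi) -> permutation,
       (forall i, B (sigma i)) & is_inflation sigma tau].

Definition wreath_closed (Y : set permutation) : Prop := wreath Y Y `<=` Y.

(* The entries of pi are distinct, so coloring them is the same as coloring
   their values; colors given to numbers that are not entries are irrelevant. *)
Definition odot (m : nat) (P : 'I_m -> set permutation) : set permutation :=
  [set pi | exists c : nat -> 'I_m, forall i,
     [seq x <- pi | c x == i] = [::] \/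
     exists2 sigma, P i sigma & order_iso [seq x <- pi | c x == i] sigma].

(* The multiset {P_1, ..., P_m} is given as a family. At least one part is
   required: otherwise the empty family would be a nontrivial splitting of the
   empty class. *)
Definition is_splitting (m : nat) (P : 'I_m -> set permutation)
    (C : set permutation) : Prop :=
  [/\ 0 < m, forall i, permutation_class (P i) & C `<=` odot P].

Definition nontrivial_splitting (m : nat) (P : 'I_m -> set permutation)
    (C : set permutation) : Prop :=
  is_splitting P C /\ forall i, ~ (C `<=` P i).

Definition splittable (C : set permutation) : Prop :=
  exists (m : nat) (P : 'I_m -> set permutation), nontrivial_splitting P C.

Definition unsplittable (C : set permutation) : Prop := ~ splittable C.

(* Main.v *)
(** If [C] is wreath-closed and no part [P_i] contains [C], pick [p_i] in [C]
    outside [P_i] and nest the inflations [p_1[p_2[...]]].  In any coloring,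
    either every block of the outermost level has an entry of color 1, so that
    [p_1] occurs in color 1, or some block avoids color 1 and one recurses into
    it; so some [p_i] occurs in color [i], which no splitting allows.
    If [pi] is simple and occurs in [rho[sigma_1, ..., sigma_n]], the occurrence
    writes [pi] as an inflation of a pattern of [rho] by patterns of the
    [sigma_i], so [pi] occurs in [rho] or in some [sigma_i].  Hence [Av pi] is
    wreath-closed. *)
Require Import Defs.
From mathcomp Require Import all_boot.
From mathcomp Require Import boolp classical_sets.
From mathcomp Require Import zify.

Set Implicit Arguments.
Unset Strict Implicit.
Unset Printing Implicit Defensive.

(** * Permutations, order isomorphism and containment *)

Lemma size_permutation_gt0 (p : permutation) : 0 < size p.
Proof. by case/andP: (one_lineP p). Qed.

Lemma permutation_perm_iota (p : permutation) : perm_eq p (iota 1 (size p)).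
Proof. by case/andP: (one_lineP p). Qed.

Lemma permutation_uniq (p : permutation) : uniq p.
Proof. by rewrite (perm_uniq (permutation_perm_iota p)) iota_uniq. Qed.

Lemma mem_permutation (p : permutation) x : (x \in one_line p) = (0 < x <= size p).
Proof. by rewrite (perm_mem (permutation_perm_iota p)) mem_iota add1n ltnS. Qed.

Lemma order_iso_sym s t : order_iso s t -> order_iso t s.
Proof. by case=> sz h; split=> // i j; rewrite -sz => hi hj; rewrite h. Qed.

Lemma order_iso_trans s t u : order_iso s t -> order_iso t u -> order_iso s u.
Proof.
case=> sz h [sz' h']; split; first by rewrite sz.
by move=> i j hi hj; rewrite h // h' // -sz.
Qed.

Lemma order_iso_map (f : nat -> nat) s :
  {in s &, {mono f : x y / x < y}} -> order_iso s (map f s).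
Proof.
move=> hf; split; first by rewrite size_map.
by move=> i j hi hj; rewrite !(nth_map 0) // hf // mem_nth.
Qed.

(** Distinct entries determine their positions, so a comparison of positions becomes a map on
    values. In this form subsequences and colorings can be transported. *)
Lemma order_isoP s t : uniq s -> order_iso s t ->
  exists2 f : nat -> nat, t = map f s & {in s &, {mono f : x y / x < y}}.
Proof.
move=> us [sz h]; exists (fun x => nth 0 t (index x s)).
  apply: (@eq_from_nth _ 0); rewrite ?size_map // -sz => i hi.
  by rewrite (nth_map 0) // index_uniq.
by move=> x y xs ys; rewrite -h ?index_mem // !nth_index.
Qed.

(** Equal entries of [s] make both strict comparisons in [t] false, which forces equal entries
    there. *)
Lemma order_iso_uniq s t : order_iso s t -> uniq t -> uniq s.
Proof.
case=> sz h ut; apply/(uniqP 0) => i j; rewrite !inE => hi hj e.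
apply: (uniqP 0 ut); rewrite ?inE -?sz //.
by move: (h i j hi hj) (h j i hj hi); rewrite e ltnn; case: ltngtP.
Qed.

Lemma contains_order_iso (sigma rho : permutation) u v :
  order_iso v sigma -> subseq u v -> order_iso u rho -> contains sigma rho.
Proof.
move=> vs uv ur; have uniqv := order_iso_uniq vs (permutation_uniq sigma).
have [f sE fmono] := order_isoP uniqv vs.
exists (map f u); first by rewrite sE map_subseq.
apply: order_iso_trans ur; apply/order_iso_sym/order_iso_map.
by move=> x y /(mem_subseq uv) xv /(mem_subseq uv) yv; apply: fmono.
Qed.

(** * Standardization of sequences of distinct numbers *)

Definition rank (s : seq nat) (x : nat) : nat := count (leq^~ x) s.

Lemma rank_mono s : {in s &, {mono rank s : x y / x < y}}.
Proof.
have le x y : x <= y -> rank s x <= rank s y.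
  by move=> xy; apply: sub_count => z /= zx; apply: leq_trans xy.
have lt x y : y \in s -> x < y -> rank s x < rank s y.
  move=> ys xy; rewrite -has_pred1 has_count in ys.
  (* Strictness: [y] itself is counted in its own rank but not in the rank of [x]. *)
  have -> : rank s y = count (ltn^~ y) s + count (pred1 y) s.
    rewrite -count_predUI (@eq_count _ (predI _ _) pred0) ?count_pred0 ?addn0.
      by apply: eq_count => z /=; rewrite leq_eqVlt orbC.
    by move=> z /=; case: eqP => [->|]; rewrite ?ltnn ?andbF.
  have : rank s x <= count (ltn^~ y) s.
    by apply: sub_count => z /= zx; apply: leq_ltn_trans xy.
  lia.
move=> x y xs ys; case: (ltnP x y) => [/(lt x y ys) //|/le]; lia.
Qed.

(** The ranks are distinct and lie between 1 and [size s], so by counting they fill this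
    interval. *)
Lemma standardize_subproof s : 0 < size s -> uniq s ->
  is_permutation (map (rank s) s).
Proof.
move=> s0 us; rewrite /is_permutation size_map s0 /=.
have ur : uniq (map (rank s) s).
  by apply: (order_iso_uniq (order_iso_sym (order_iso_map (@rank_mono s)))).
have sub : {subset map (rank s) s <= iota 1 (size s)}.
  move=> _ /mapP[x xs ->]; rewrite mem_iota add1n ltnS count_size andbT.
  by rewrite -has_count; apply/hasP; exists x => /=.
apply: uniq_perm; rewrite ?iota_uniq //.
by have [] := uniq_min_size ur sub _; rewrite ?size_iota ?size_map.
Qed.

Definition standardize s (s0 : 0 < size s) (us : uniq s) : permutation :=
  Permutation (standardize_subproof s0 us).

Lemma order_iso_standardize s (s0 : 0 < size s) (us : uniq s) :
  order_iso s (standardize s0 us).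
Proof. exact/order_iso_map/rank_mono. Qed.

Lemma rank_permutation (p : permutation) : {in one_line p, rank p =1 id}.
Proof.
move=> x; rewrite mem_permutation => /andP[x0 xp].
(* Cut 1, ..., [size p] after [x]: the first piece is counted entirely, the second not at all. *)
rewrite /rank (permP (permutation_perm_iota p)) -(subnKC xp) iotaD count_cat.
rewrite (@eq_in_count _ _ predT) ?count_predT ?size_iota.
  rewrite (@eq_in_count _ _ pred0) ?count_pred0 ?addn0 // => y.
  by rewrite mem_iota /=; lia.
by move=> y; rewrite mem_iota /=; lia.
Qed.

(** Ranks depend only on the order type, and each entry of a permutation is its own rank. *)
Lemma map_rank_order_iso s (p : permutation) :
  order_iso s p -> map (rank s) s = p.
Proof.
move=> sp; have us := order_iso_uniq sp (permutation_uniq p).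
have [f pE fmono] := order_isoP us sp.
rewrite -[RHS](map_id_in (@rank_permutation p)) pE -map_comp.
apply/eq_in_map => x xs /=; rewrite /rank count_map.
by apply: eq_in_count => y ys /=; rewrite [LHS]leqNgt [RHS]leqNgt fmono.
Qed.

(* The blocks need only be given up to an order isomorphism of the whole
   sequence: their entries are replaced by their ranks. *)
Lemma is_inflation_order_iso (rho : permutation)
    (sigma : 'I_(size rho) -> permutation) (b : 'I_(size rho) -> seq nat)
    (tau : permutation) :
  order_iso (flatten [seq b i | i <- enum 'I_(size rho)]) tau ->
  (forall i, order_iso (b i) (sigma i)) ->
  (forall i j : 'I_(size rho), nth 0 rho i < nth 0 rho j ->
     forall x y, x \in b i -> y \in b j -> x < y) ->
  is_inflation sigma tau.
Proof.
set s := flatten _ => st bsigma sep.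
have sub i x : x \in b i -> x \in s.
  move=> xb; apply/flattenP; exists (b i) => //.
  by apply/mapP; exists i; rewrite ?mem_enum.
exists (fun i => map (rank s) (b i)); split.
- by rewrite -(map_rank_order_iso st) /s map_flatten -map_comp.
- move=> i; apply: order_iso_trans (bsigma i).
  apply/order_iso_sym/order_iso_map => x y xb yb.
  by apply: rank_mono; apply: sub; eassumption.
- move=> i j ij _ _ /mapP[x xb ->] /mapP[y yb ->].
  by rewrite (rank_mono (sub _ _ xb) (sub _ _ yb)) (sep _ _ ij _ _ xb yb).
Qed.

(** * Existence of inflations, and subsequences of concatenated blocks *)

Lemma inflation_constant_exists (rho sigma : permutation) :
  exists tau, @is_inflation rho (fun=> sigma) tau.
Proof.
set N := size sigma.
(* Entries of [sigma] lie in 1, ..., [N], so shifting by multiples of [N] puts the blocks into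
   disjoint intervals ordered as in [rho]. *)
pose b (i : 'I_(size rho)) := [seq nth 0 rho i * N + x | x <- sigma].
pose s := flatten [seq b i | i <- enum 'I_(size rho)].
have us : uniq s.
  apply: allpairs_uniq; rewrite ?enum_uniq ?permutation_uniq //.
  move=> [i x] [j y] /allpairsP[[i' x'] /= [_ hx [-> ->]]].
  move=> /allpairsP[[j' y'] /= [_ hy [-> ->]]] /= e.
  move: hx hy; rewrite !mem_permutation -/N => hx hy.
  have eij : nth 0 rho i' = nth 0 rho j' by nia.
  have -> : x' = y' by nia.
  congr (_, _); apply: val_inj.
  by apply/eqP; rewrite -(nth_uniq 0 _ _ (permutation_uniq rho)) ?ltn_ord // eij.
have s0 : 0 < size s.
  rewrite size_allpairs size_enum_ord muln_gt0.
  by rewrite !size_permutation_gt0.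
exists (standardize s0 us).
apply: (@is_inflation_order_iso _ _ b); first exact: order_iso_standardize.
  by move=> i; apply/order_iso_sym/order_iso_map => x y _ _; rewrite ltn_add2l.
move=> i j ij _ _ /mapP[x hx ->] /mapP[y hy ->].
by move: hx hy; rewrite !mem_permutation -/N; nia.
Qed.

Lemma subseq_flatten_block (I T : eqType) (b : I -> seq T) (r : seq I) i :
  i \in r -> subseq (b i) (flatten (map b r)).
Proof.
elim: r => //= j r IH; rewrite inE => /predU1P[->|/IH]; first exact: prefix_subseq.
by move/subseq_trans; apply; apply: suffix_subseq.
Qed.

Lemma subseq_flatten_pick (I T : eqType) (x : I -> T) (b : I -> seq T)
    (r : seq I) :
  (forall i, x i \in b i) -> subseq (map x r) (flatten (map b r)).
Proof.
move=> xb; elim: r => //= i r IH.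
by rewrite -cat1s; apply: cat_subseq; rewrite ?sub1seq.
Qed.

Lemma map_nth_enum_ord (T : Type) (x0 : T) (s : seq T) :
  [seq nth x0 s i | i : 'I_(size s) <- enum 'I_(size s)] = s.
Proof. by rewrite -[RHS](mkseq_nth x0) /mkseq -val_enum_ord -map_comp. Qed.

(** * Wreath-closed classes are unsplittable *)

(** Induction on the list [l] of allowed colors, with [tau] chosen before the coloring. For empty
    [l] any nonempty [tau0] works, since its entries have no allowed color. *)
Lemma wreath_closed_ramsey (C : set permutation) (K : eqType)
    (p : K -> permutation) (tau0 : permutation) (l : seq K) :
  wreath_closed C -> C tau0 -> (forall k, C (p k)) ->
  exists2 tau, C tau & forall c : nat -> K,
    {in one_line tau, forall x, c x \in l} ->
    exists k, exists2 u, subseq u [seq x <- tau | c x == k] & order_iso u (p k).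
Proof.
move=> Cw Ctau0 Cp; elim: l => [|k l [sigma Csigma IH]].
  exists tau0 => // c /(_ (nth 0 tau0 0)).
  by rewrite mem_nth ?size_permutation_gt0 // => /(_ isT).
have [tau inf] := inflation_constant_exists (p k) sigma.
exists tau; first by apply: Cw; exists (p k) => //; exists (fun=> sigma).
case: inf => b [tauE bsigma sep] c cl.
have bsub i : subseq (b i) tau.
  by rewrite tauE; apply: subseq_flatten_block; rewrite mem_enum.
have [/forallP hk|] := boolP [forall i, has (fun x => c x == k) (b i)].
  (* One entry of color [k] from each block; since the blocks are ordered like [p k], these entries
     form a copy of it. *)
  pose x i := nth 0 (b i) (find (fun x => c x == k) (b i)).
  have xb i : x i \in b i by rewrite mem_nth // -has_find.
  have cx i : c (x i) == k by apply: (nth_find 0 (hk i)).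
  exists k, [seq x i | i <- enum 'I_(size (p k))].
    rewrite tauE filter_flatten -map_comp; apply: subseq_flatten_pick => i /=.
    by rewrite mem_filter cx xb.
  have sz : size [seq x i | i <- enum 'I_(size (p k))] = size (p k).
    by rewrite size_map size_enum_ord.
  split=> // i j; rewrite sz => hi hj.
  have nx (h : 'I_(size (p k))) :
      nth 0 [seq x i | i <- enum 'I_(size (p k))] h = x h.
    by rewrite (nth_map h) ?size_enum_ord // nth_ord_enum.
  rewrite (nx (Ordinal hi)) (nx (Ordinal hj)).
  case: (ltngtP (nth 0 (p k) i) (nth 0 (p k) j)) => [ij|ji|/eqP ij].
  - exact: (sep (Ordinal hi) (Ordinal hj)).
  - by apply/negbTE; rewrite -leqNgt ltnW // (sep (Ordinal hj) (Ordinal hi)).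
  - rewrite nth_uniq ?permutation_uniq // in ij.
    suff -> : Ordinal hi = Ordinal hj by rewrite ltnn.
    by apply: val_inj; apply/eqP.
rewrite negb_forall => /existsP[i /hasPn ck].
have [f bE fmono] := order_isoP (permutation_uniq sigma) (order_iso_sym (bsigma i)).
(* The block [b i] is only a copy of [sigma], so its coloring, which omits [k], is pulled back along
   [f]. *)
have [|k' [u usub uk']] := IH (c \o f).
  move=> x xs; have fxb : f x \in b i by rewrite bE map_f.
  have := cl _ (mem_subseq (bsub i) fxb).
  by rewrite inE (negbTE (ck _ fxb)).
exists k', (map f u).
  apply: (@subseq_trans _ [seq x <- b i | c x == k']).
    by rewrite bE filter_map map_subseq.
  by rewrite subseq_filter filter_all (subseq_trans (filter_subseq _ _)).
apply: order_iso_trans uk'; apply/order_iso_sym/order_iso_map.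
have us : {subset u <= one_line sigma}.
  by move=> x /(mem_subseq usub); rewrite mem_filter => /andP[].
by move=> x y /us xs /us ys; apply: fmono.
Qed.

Lemma wreath_closed_unsplittable (C : set permutation) :
  wreath_closed C -> unsplittable C.
Proof.
move=> Cw [m [P [[m0 Pcl CP] nCP]]].
have /choice[p pP] : forall i, exists q, C q /\ ~ P i q.
  by move=> i; have [q [? ?]] := nonsubset (nCP i); exists q.
have [||tau Ctau ramsey] := @wreath_closed_ramsey C _ p (p (Ordinal m0)) (enum 'I_m) Cw.
- by case: (pP (Ordinal m0)).
- by move=> i; case: (pP i).
have [c cP] := CP _ Ctau.
have [|i [u usub up]] := ramsey c; first by move=> x _; rewrite mem_enum.
case: (pP i) => _; apply; case: (cP i) => [e|[sigma Psigma iso]].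
  move: usub; rewrite e subseq0 => /eqP u0; case: up => sz _.
  by have := size_permutation_gt0 (p i); rewrite -sz u0.
exact: Pcl Psigma (contains_order_iso iso usub up).
Qed.

(** * Classes avoiding a simple permutation are wreath-closed *)

Lemma flatten_filter_nonnil (I : Type) (T : eqType) (b : I -> seq T) (r : seq I) :
  flatten [seq b i | i <- r & b i != [::]] = flatten [seq b i | i <- r].
Proof. by elim: r => //= i r IH; case: eqP => [->|_] //=; rewrite IH. Qed.

Lemma simple_Av_wreath_closed (pi : permutation) :
  simple_permutation pi -> wreath_closed (Av pi).
Proof.
move=> simple tau [rho Avrho [sigma Avsigma [b [tauE bsigma sep]]]] [s stau spi].
set n := size rho in sigma Avsigma b tauE bsigma sep.
have us : uniq s := subseq_uniq stau (permutation_uniq tau).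
pose B i := [seq x <- b i | x \in s].
have sE : s = flatten [seq B i | i <- enum 'I_n].
  rewrite {1}(subseq_uniqP (permutation_uniq tau) stau) tauE filter_flatten.
  by rewrite -map_comp.
(* Inflation requires nonempty blocks, so only the blocks of [tau] that meet the occurrence [s] are
   kept. *)
pose L := [seq i <- enum 'I_n | B i != [::]].
have {}sE : s = flatten [seq B i | i <- L] by rewrite flatten_filter_nonnil.
have uB i : uniq (B i).
  exact: filter_uniq (order_iso_uniq (bsigma i) (permutation_uniq _)).
pose r := [seq nth 0 rho i | i : 'I_n <- L].
have rsub : subseq r rho.
  rewrite -[X in subseq _ X](map_nth_enum_ord 0) /r.
  by apply: map_subseq; apply: filter_subseq.
have ur : uniq r := subseq_uniq rsub (permutation_uniq rho).
have L0 : 0 < size L.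
  case: spi => sz _; have := size_permutation_gt0 pi; rewrite -sz sE.
  by case: (L).
have r0 : 0 < size r by rewrite size_map.
pose rho' := standardize r0 ur.
have szrho' : size rho' = size L by rewrite !size_map.
(* Only a default value for [nth]; all indices used are within [L]. *)
pose i0 : 'I_n := Ordinal (size_permutation_gt0 rho).
pose g (j : 'I_(size rho')) := nth i0 L j.
have gL j : g j \in L by rewrite mem_nth // -szrho'.
have B0 j : 0 < size (B (g j)).
  by have := gL j; rewrite mem_filter; case: (B (g j)).
pose sigma' j := standardize (B0 j) (uB (g j)).
have mapg : [seq g j | j <- enum 'I_(size rho')] = L.
  by rewrite /g szrho' map_nth_enum_ord.
have inf : is_inflation sigma' pi.
  apply: (@is_inflation_order_iso _ _ (fun j => B (g j))).
  - by rewrite (map_comp B g) mapg -sE.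
  - by move=> j; apply: order_iso_standardize.
  move=> i j ij x y; rewrite !mem_filter => /andP[_ xb] /andP[_ yb].
  apply: sep xb yb; move: ij.
  case: (order_iso_standardize r0 ur) => szr <-; rewrite ?szr //.
  by rewrite /r !(nth_map i0) -?szrho'.
(* If all blocks are singletons, [r] is an occurrence of [pi] in [rho]; if there is a single block,
   it is an occurrence of [pi] inside one [sigma i]. *)
have [[rhoE _]|[_ sigmaE]] := simple _ _ inf.
  apply: Avrho; exists r => //.
  by rewrite -rhoE; apply: order_iso_standardize.
pose j0 : 'I_(size rho') := Ordinal (size_permutation_gt0 rho').
apply: (Avsigma (g j0)).
apply: (contains_order_iso (bsigma (g j0)) (filter_subseq (mem s) _)).
by rewrite -(sigmaE j0); apply: order_iso_standardize.
Qed.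

Theorem corollary2p5 :
  (forall C : set permutation,
     permutation_class C -> wreath_closed C -> unsplittable C) /\
  (forall pi : permutation, simple_permutation pi -> unsplittable (Av pi)).
Proof.
split=> [C _|pi pi_simple]; first exact: wreath_closed_unsplittable.
exact/wreath_closed_unsplittable/simple_Av_wreath_closed.
Qed.
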